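(* Let $q\ge1$, let $p\in\mathbb N$ be such that $q\in\{2p-1,2p\}$, and let $V_c\in\mathcal J_q^c$. Then the Fredholm determinant $D_c(k)$, $k\in\mathbb D$, satisfies $$\mathfrak f(k)=D_c(k)\det\mathcal T_p\qquad\text{for all } k\in\mathbb D,$$ and then (with $D_c$ continued analytically) for all $k\in\mathbb C$. Moreover, if $V\in\mathcal J_q$ (the self-adjoint case), then $\mathfrak f$ is real on the real line and the resonances are symmetric with respect to the real line.
   Context: Let $d\ge1$, let $\mathbb M_d$ be the complex $d\times d$ matrices, $\mathbf 1$ the identity, $\mathbb N=\{1,2,\dots\}$, $\mathbb D=\{|k|<1\}$. On $\ell^2(\mathbb N,\mathbb C^d)$ (with $y_0=0$) put $(H_oy)_x=y_{x-1}+y_{x+1}$ and, for sequences $a_x,s_x,b_x\in\mathbb M_d$ ($x\ge1$) with the convention $a_0=\mathbf 1$, $$(V_cy)_x=(a_{x-1}-\mathbf 1)y_{x-1}+b_xy_x+(s_x-\mathbf 1)y_{x+1},\qquad H_c=H_o+V_c .$$ Class $\mathcal J_q^c$, $q\in\{2p-1,2p\}$, $p\in\mathbb N$: all $V_c$ such that $a_x,s_x$ are invertible for all $x\ge1$; $a_x=s_x=\mathbf 1$ and $b_x=0$ for all $x>p$; and, if $q=2p-1$, $a_p=s_p=\mathbf 1$ and $\det b_p\ne0$, while if $q=2p$, $\det(\mathbf 1-s_pa_p)\neq0$. The class $\mathcal J_q$ is the subset of $\mathcal J_q^c$ with $a_x=s_x>0$ (positive definite) and $b_x=b_x^*$ for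 all $x\ge1$. Jost solution: for $k\ne0$, $f_x(k)\in\mathbb M_d$, $x\ge0$, is the solution of $a_{x-1}f_{x-1}+s_xf_{x+1}+b_xf_x=(k+k^{-1})f_x$, $x\ge1$, with $f_x(k)=k^x\mathbf 1$ for all $x>p$. The Jost determinant $\mathfrak f(k)=\det f_0(k)$ is a polynomial in $k$. Resonances are the zeros of $\mathfrak f$ in $\mathbb C\setminus\overline{\mathbb D}$ (together with possible zeros at $\pm1$). $\mathcal T_p=a_1^{-1}a_2^{-1}\cdots a_p^{-1}$. The Fredholm determinant is $D_c(k)=\det(I+V_cR_o(\lambda))$, where $R_o(\lambda)=(H_o-\lambda)^{-1}$, $\lambda=k+\frac1k$, $k\in\mathbb D$ (at $k=0$, i.e. $\lambda=\infty$, by continuity, $D_c(0)=1$). *)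

(* Defs.v *)
From HB Require Import structures.
From mathcomp Require Import all_boot all_order all_algebra.
From mathcomp Require Import all_classical all_reals all_analysis.
From mathcomp Require Import complex.
Set Implicit Arguments.
Unset Strict Implicit.
Unset Printing Implicit Defensive.
Import Order.TTheory GRing.Theory Num.Theory.
Import numFieldNormedType.Exports.
Local Open Scope classical_set_scope.
Local Open Scope ring_scope.
Local Open Scope sesquilinear_scope.

Section MatrixJacobi.
Variables (R : realType) (d : nat).
Local Notation C := R[i].

(* A sequence (y_x) indexed by x = 1, 2, ... is a function on nat whose value
   at 0 is the boundary value; y_0 = 0 is part of membership in l2. *)
Definition vseq : Type := nat -> 'cV[C]_d.

Definition l2 (y : vseq) : Prop :=
  y 0%N = 0 /\
  (\sum_(0 <= x <oo) (\sum_(j < d) complex.Re `|y x j 0| ^+ 2)%:E < +oo)%E.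

Definition Ho (y : vseq) : vseq :=
  fun x => if x is x'.+1 then y x' + y x'.+2 else 0.

Definition Vc (a s b : nat -> 'M[C]_d) (y : vseq) : vseq :=
  fun x => if x is x'.+1 then
      (a x' - 1%:M) *m y x' + b x'.+1 *m y x'.+1 + (s x'.+1 - 1%:M) *m y x'.+2
    else 0.

(* (Ho - lam)^-1 on l2: [Ro lam y] is the u in l2 with (Ho - lam) u = y.  It is
   meaningful for y in l2 and lam in the resolvent set of Ho, in particular for
   lam = k + k^-1 with 0 < |k| < 1; otherwise it may be a junk value. *)
Definition Ro (lam : C) (y : vseq) : vseq :=
  xget (fun=> 0) [set u | l2 u /\ (fun x => Ho u x - lam *: u x) = y].

Definition ebasis (t : nat * 'I_d) : vseq :=
  fun x => if x == t.1 then delta_mx t.2 0 else 0.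

Definition entry (A : vseq -> vseq) (s t : nat * 'I_d) : C :=
  A (ebasis t) s.1 s.2 0.

Definition site (N : nat) (t : 'I_N * 'I_d) : nat * 'I_d := (t.1.+1, t.2).

Definition minor (A : vseq -> vseq) (N : nat) (S : {set 'I_N * 'I_d}) : C :=
  \det (\matrix_(i < #|S|, j < #|S|)
          entry A (site (enum_val i)) (site (enum_val j))).

(* Trace of the n-th exterior power of A: its diagonal entry at
   e_{t_1} /\ ... /\ e_{t_n} is the principal minor of A on {t_1, ..., t_n};
   the sum over all n-subsets of the orthonormal basis is the limit of the sums
   over the n-subsets carried by the sites 1, ..., N. *)
Definition trace_ext (A : vseq -> vseq) (n : nat) : C :=
  limn ((fun N => \sum_(S : {set 'I_N * 'I_d} | #|S| == n) minor A S)
          : nat -> C^o).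

(* det(I + A) = \sum_n Tr (Lambda^n A), for A trace class on l2. *)
Definition fredholm_det (A : vseq -> vseq) : C :=
  limn (series (trace_ext A : nat -> C^o)).

Definition Dc (a s b : nat -> 'M[C]_d) (k : C) : C :=
  if k == 0 then 1 else fredholm_det (Vc a s b \o Ro (k + k^-1)).

(* The class J_q^c.  Only a 0 = 1 matters at index 0 (s 0 and b 0 are never
   used); V_c is given by its coefficients. *)
Definition Jqc (q p : nat) (a s b : nat -> 'M[C]_d) : Prop :=
  [/\ a 0%N = 1%:M,
      forall x, (0 < x)%N -> a x \in unitmx /\ s x \in unitmx,
      forall x, (p < x)%N -> [/\ a x = 1%:M, s x = 1%:M & b x = 0],
      q = (2 * p - 1)%N -> [/\ a p = 1%:M, s p = 1%:M & \det (b p) != 0]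
    & q = (2 * p)%N -> \det (1%:M - s p *m a p) != 0].

Definition posdefmx (A : 'M[C]_d) : Prop :=
  A = A ^t* /\ forall v : 'cV[C]_d, v != 0 -> 0 < (v ^t* *m A *m v) 0 0.

Definition Jq (q p : nat) (a s b : nat -> 'M[C]_d) : Prop :=
  Jqc q p a s b /\
  forall x, (0 < x)%N -> [/\ a x = s x, posdefmx (a x) & b x = (b x) ^t*].

Definition is_jost (p : nat) (a s b : nat -> 'M[C]_d) (k : C)
    (f : nat -> 'M[C]_d) : Prop :=
  (forall x, (0 < x)%N ->
     a x.-1 *m f x.-1 + s x *m f x.+1 + b x *m f x = (k + k^-1) *: f x) /\
  (forall x, (p < x)%N -> f x = (k ^+ x)%:M).

Definition jost (p : nat) (a s b : nat -> 'M[C]_d) (k : C) : nat -> 'M[C]_d :=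
  xget (fun=> 0) [set f | is_jost p a s b k f].

(* The Jost determinant k |-> det f_0(k), defined for k != 0, as a polynomial
   in k (unique since C is infinite); this fixes its value at k = 0. *)
Definition jost_det (p : nat) (a s b : nat -> 'M[C]_d) : {poly C} :=
  xget 0 [set P : {poly C} | forall k, k != 0 -> P.[k] = \det (jost p a s b k 0%N)].

Definition is_resonance (p : nat) (a s b : nat -> 'M[C]_d) (k : C) : Prop :=
  root (jost_det p a s b) k /\ (1 < `|k| \/ k = 1 \/ k = -1).

Definition Tp (p : nat) (a : nat -> 'M[C]_d) : 'M[C]_d :=
  \big[mulmx/1%:M]_(1 <= x < p.+1) invmx (a x).

End MatrixJacobi.

Definition entire (R : realType) (g : R[i] -> R[i]) : Prop :=
  forall k : R[i], derivable (g : R[i]^o -> R[i]^o) k 1.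

(* Main.v *)
Require Import Defs.
From HB Require Import structures.
From mathcomp Require Import all_boot all_order all_algebra perm.
From mathcomp Require Import all_classical all_reals all_analysis.
From mathcomp Require Import complex ring lra.
Set Implicit Arguments.
Unset Strict Implicit.
Unset Printing Implicit Defensive.
Import Order.TTheory GRing.Theory Num.Theory.
Import numFieldNormedType.Exports.
Import Normc.
Local Open Scope ring_scope.

(* Since V_c has its range in the sites 1, ..., p+1, D_c is the determinant of
   the compression of 1 + V_c R_o to these sites.  A decaying solution of the
   free equation satisfies y_{p+2} = k y_{p+1}; hence the compressed resolvent G
   is the inverse of L = the truncation of H_o - lambda with k added to the last
   diagonal block, and 1 + V_c G = M G, where M is built from H_c as L from H_o.
   So D_c = det M / det L.  Applying M to the column of Jost matrices
   (f_1, ..., f_{p+1}) gives (-f_0, 0, ..., 0), and this yields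
   det M = det L det f_0 det a_1 ... det a_p for all k <> 0.  In the self-adjoint
   case M(k)^* = M(conj k), so this identity also gives the symmetry of det f_0. *)

(** * Determinants of matrices indexed by a finite type *)

Section FinDet.
Variable K : comNzRingType.

(** Indexing by a finite type allows pairs (site, component) as indices. Rows and columns follow the
    same enumeration, so its order does not affect the value. *)
Definition fdet (T : finType) (A : T -> T -> K) : K :=
  \det (\matrix_(i < #|T|, j < #|T|) A (enum_val i) (enum_val j)).

Lemma eq_fdet (T : finType) (A B : T -> T -> K) : A =2 B -> fdet A = fdet B.
Proof. by move=> AB; congr (\det _); apply/matrixP=> i j; rewrite !mxE AB. Qed.

(** Rows and columns undergo the same permutation, whose sign enters twice and cancels. *)
Lemma det_reindex m n (e : 'I_m -> 'I_n) (A : 'M[K]_n) : bijective e ->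
  \det (\matrix_(i, j) A (e i) (e j)) = \det A.
Proof.
move=> be; have mn : m = n by rewrite -(card_ord m) -(card_ord n) (bij_eq_card be).
case: n / mn e A be => e A be.
have -> : \matrix_(i, j) A (e i) (e j) =
    row_perm (perm (bij_inj be)) (col_perm (perm (bij_inj be)) A).
  by apply/matrixP=> i j; rewrite !mxE !permE.
by rewrite row_permE col_permE !det_mulmx !det_perm odd_permV mulrC -mulrA -signr_addb addbb mulr1.
Qed.

Lemma fdet_ord m (T : finType) (e : 'I_m -> T) (A : T -> T -> K) : bijective e ->
  \det (\matrix_(i, j) A (e i) (e j)) = fdet A.
Proof.
move=> be; rewrite /fdet -(det_reindex _ (bij_comp (enum_rank_bij T) be)).
by congr (\det _); apply/matrixP=> i j; rewrite !mxE /= !enum_rankK.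
Qed.

Lemma fdet_mx n (A : 'M[K]_n) : fdet A = \det A.
Proof.
rewrite -(fdet_ord (e := id) A); last by exists id.
by congr (\det _); apply/matrixP=> i j; rewrite mxE.
Qed.

Lemma fdet_reindex (S T : finType) (e : S -> T) (A : T -> T -> K) : bijective e ->
  fdet (fun i j => A (e i) (e j)) = fdet A.
Proof. by move=> be; rewrite -(fdet_ord A (bij_comp be (enum_val_bij S))). Qed.

Lemma fdet_tr (T : finType) (A : T -> T -> K) : fdet (fun i j => A j i) = fdet A.
Proof. by rewrite /fdet -det_tr; congr (\det _); apply/matrixP=> i j; rewrite !mxE. Qed.

Lemma fdetM (T : finType) (A B : T -> T -> K) :
  fdet (fun i j => \sum_v A i v * B v j) = fdet A * fdet B.
Proof.
rewrite /fdet -det_mulmx; congr (\det _); apply/matrixP=> i j; rewrite !mxE.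
rewrite (reindex (@enum_val T predT)) /=; last exact/onW_bij/enum_val_bij.
by apply: eq_bigr => v _; rewrite !mxE.
Qed.

Lemma fdet1 (T : finType) : fdet (fun i j : T => (i == j)%:R) = 1.
Proof.
rewrite /fdet -[RHS](det1 _ #|T|); congr (\det _); apply/matrixP=> i j; rewrite !mxE.
by rewrite (inj_eq enum_val_inj).
Qed.


(** Enumerates [S] before [T], the order in which a matrix over [S + T] takes the form
    [block_mx]. *)
Definition sum_rank_inv (S T : finType) (i : 'I_(#|S| + #|T|)) : S + T :=
  match fintype.split i with inl x => inl (enum_val x) | inr y => inr (enum_val y) end.

Lemma sum_rank_inv_bij (S T : finType) : bijective (@sum_rank_inv S T).
Proof.
exists (fun t : S + T => match t with inl x => lshift _ (enum_rank x)
                                 | inr y => rshift _ (enum_rank y) end).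
  by move=> i; rewrite /sum_rank_inv; case: splitP => j ij; apply: val_inj; rewrite /= enum_valK ij.
by case=> x; rewrite /sum_rank_inv ?(unsplitK (inl _)) ?(unsplitK (inr _)) enum_rankK.
Qed.

Lemma sum_rank_inv_block (S T : finType) (A : S + T -> S + T -> K) :
  \matrix_(i, j) A (sum_rank_inv i) (sum_rank_inv j) =
  block_mx (\matrix_(i, j) A (inl (enum_val i)) (inl (enum_val j)))
           (\matrix_(i, j) A (inl (enum_val i)) (inr (enum_val j)))
           (\matrix_(i, j) A (inr (enum_val i)) (inl (enum_val j)))
           (\matrix_(i, j) A (inr (enum_val i)) (inr (enum_val j))).
Proof.
apply/matrixP=> i j; rewrite !mxE /sum_rank_inv.
by case: splitP => i' _; rewrite !mxE; case: splitP => j' _; rewrite !mxE.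
Qed.

Lemma fdet_upper (S T : finType) (A : S + T -> S + T -> K) :
  (forall i j, A (inr i) (inl j) = 0) ->
  fdet A = fdet (fun i j => A (inl i) (inl j)) * fdet (fun i j => A (inr i) (inr j)).
Proof.
move=> A0; rewrite -(fdet_ord A (@sum_rank_inv_bij S T)) sum_rank_inv_block.
rewrite -[X in block_mx _ _ X](_ : 0 = _) ?det_ublock //.
by apply/matrixP=> i j; rewrite !mxE A0.
Qed.

Lemma fdet_lower (S T : finType) (A : S + T -> S + T -> K) :
  (forall i j, A (inl i) (inr j) = 0) ->
  fdet A = fdet (fun i j => A (inl i) (inl j)) * fdet (fun i j => A (inr i) (inr j)).
Proof.
move=> A0; rewrite -fdet_tr fdet_upper; last by move=> i j; rewrite A0.
by congr (_ * _); rewrite -fdet_tr.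
Qed.

(** With the indices in [J] listed first, the matrix is block upper triangular with an identity
    block in the lower corner. *)
Lemma fdet_rows_minor (T : finType) (A : T -> T -> K) (J : {set T}) :
  fdet (fun i j => if i \in J then A i j else (i == j)%:R) =
  \det (\matrix_(i < #|J|, j < #|J|) A (enum_val i) (enum_val j)).
Proof.
pose e (t : 'I_#|J| + 'I_#|~: J|) : T :=
  match t with inl x => enum_val x | inr y => enum_val y end.
have ie : injective e.
  move=> [x|x] [y|y] /= exy; try by rewrite (enum_val_inj exy).
    by have := enum_valP y; rewrite -exy inE enum_valP.
  by have := enum_valP x; rewrite exy inE enum_valP.
have be : bijective e.
  by apply: inj_card_bij ie _; rewrite card_sum !card_ord cardsC.
rewrite -(fdet_reindex _ be) fdet_upper => [|i j] /=.
  have nJ (i : 'I_#|~: J|) : (enum_val i \in J) = false.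
    by have := enum_valP i; rewrite inE => /negbTE.
  rewrite -[RHS]mulr1; congr (_ * _).
    by rewrite -fdet_mx; apply: eq_fdet => i j; rewrite enum_valP mxE.
  rewrite -[RHS](fdet1 'I_#|~: J|); apply: eq_fdet => i j.
  by rewrite nJ (inj_eq enum_val_inj).
have := enum_valP i; rewrite inE => /negbTE ->.
by case: eqP => // eij; have := enum_valP i; rewrite inE eij enum_valP.
Qed.

(** Each factor of a Leibniz product is an entry of the identity plus one of [A]. Distributing the
    product selects the set [J] of rows taken from [A], and [fdet_rows_minor] evaluates each
    choice. *)
Lemma fdet_add1 (T : finType) (A : T -> T -> K) :
  fdet (fun i j => (i == j)%:R + A i j) =
  \sum_(J : {set T}) \det (\matrix_(i < #|J|, j < #|J|) A (enum_val i) (enum_val j)).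
Proof.
under eq_bigr => J _ do rewrite -fdet_rows_minor.
rewrite /fdet [LHS]/determinant.
under [in RHS]eq_bigr => J _ do rewrite /determinant.
rewrite [RHS]exchange_big; apply: eq_bigr => s _ /=.
rewrite -big_distrr /=; congr (_ * _).
have ro (F : 'I_#|T| -> K) : \prod_i F i = \prod_(t : T) F (enum_rank t).
  by rewrite (reindex (@enum_rank T)) //; exact/onW_bij/enum_rank_bij.
rewrite ro.
under eq_bigr => t _ do rewrite mxE enum_rankK addrC.
rewrite bigA_distr; apply: eq_bigr => J _; rewrite ro.
by apply: eq_bigr => t _; rewrite mxE enum_rankK.
Qed.

End FinDet.

Lemma rmorph_fdet (K L : comNzRingType) (f : {rmorphism K -> L}) (T : finType)
    (A : T -> T -> K) :
  f (fdet A) = fdet (fun i j => f (A i j)).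
Proof.
by rewrite /fdet -det_map_mx; congr (\det _); apply/matrixP=> i j; rewrite !mxE.
Qed.

(** * Determinants of block matrices over sites *)

Section BlockDet.
Variables (K : comNzRingType) (d : nat).

(** Presents the last site as a separate summand, so that [fdet_upper] and [fdet_lower] can split it
    off. *)
Definition add_site n (t : 'I_n * 'I_d + 'I_d) : 'I_n.+1 * 'I_d :=
  match t with inl u => (lift ord_max u.1, u.2) | inr i => (ord_max, i) end.

Lemma add_site_bij n : bijective (@add_site n).
Proof.
apply: inj_card_bij => [[[x i]|i] [[y j]|j]|] /=.
- by move/eqP; rewrite xpair_eqE (inj_eq lift_inj) => /andP[/eqP -> /eqP ->].
- by move/eqP; rewrite xpair_eqE eq_sym (negbTE (neq_lift _ _)).
- by move/eqP; rewrite xpair_eqE (negbTE (neq_lift _ _)).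
- by case=> ->.
- by rewrite card_sum !card_prod !card_ord mulSn addnC.
Qed.

Definition block_det n (A : 'I_n -> 'I_n -> 'M[K]_d) : K :=
  fdet (fun s t : 'I_n * 'I_d => A s.1 t.1 s.2 t.2).

Lemma eq_block_det n (A B : 'I_n -> 'I_n -> 'M[K]_d) : A =2 B -> block_det A = block_det B.
Proof. by move=> AB; apply: eq_fdet => i j; rewrite AB. Qed.

Lemma block_detM n (A B : 'I_n -> 'I_n -> 'M[K]_d) :
  block_det (fun x y => \sum_z A x z *m B z y) = block_det A * block_det B.
Proof.
rewrite -fdetM; apply: eq_fdet => [[x i] [y j]] /=.
rewrite summxE -(pair_bigA _ (fun z l => A x z i l * B z y l j)) /=.
by apply: eq_bigr => z _; rewrite mxE.
Qed.

Lemma block_det1 n : block_det (fun x y : 'I_n => (x == y)%:R%:M) = 1.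
Proof.
rewrite -[RHS](fdet1 K ('I_n * 'I_d)%type); apply: eq_fdet => [[x i] [y j]].
by rewrite mxE xpair_eqE /=; case: eqP => _; case: eqP.
Qed.

Lemma block_det_recr_col n (A : 'I_n.+1 -> 'I_n.+1 -> 'M[K]_d) :
  (forall x, A (lift ord_max x) ord_max = 0) ->
  block_det A = block_det (fun x y => A (lift ord_max x) (lift ord_max y)) *
           \det (A ord_max ord_max).
Proof.
move=> A0; rewrite /block_det -(fdet_reindex _ (add_site_bij n)) fdet_lower /=.
  by rewrite -fdet_mx.
by move=> i j; rewrite A0 mxE.
Qed.

Lemma block_det_recr_row n (A : 'I_n.+1 -> 'I_n.+1 -> 'M[K]_d) :
  (forall y, A ord_max (lift ord_max y) = 0) ->
  block_det A = block_det (fun x y => A (lift ord_max x) (lift ord_max y)) *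
           \det (A ord_max ord_max).
Proof.
move=> A0; rewrite /block_det -(fdet_reindex _ (add_site_bij n)) fdet_upper /=.
  by rewrite -fdet_mx.
by move=> i j; rewrite A0 mxE.
Qed.

Lemma block_det_triangular n (A : 'I_n -> 'I_n -> 'M[K]_d) :
  (forall x y : 'I_n, (y < x)%N -> A x y = 0) ->
  block_det A = \prod_(x < n) \det (A x x).
Proof.
elim: n A => [|n IHn] A A0.
  rewrite big_ord0 -[RHS](block_det1 0); apply: eq_block_det => x; by case: x.
rewrite block_det_recr_row => [|y]; last by apply: A0; rewrite lift_max.
rewrite IHn => [|x y yx]; last by apply: A0; rewrite !lift_max.
rewrite big_ord_recr /=; congr (_ * _); apply: eq_bigr => x _.
suff -> : lift ord_max x = widen_ord (leqnSn n) x by [].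
by apply: val_inj; apply: lift_max.
Qed.

(** The rows of the sites from [N] on are rows of the identity, so the last site splits off with
    factor 1, one site at a time. *)
Lemma fdet_zero_rows N m (A : nat * 'I_d -> nat * 'I_d -> K) :
  (forall s t, (N <= s.1)%N -> A s t = 0) ->
  fdet (fun s t : 'I_(N + m) * 'I_d =>
          (s == t)%:R + A (s.1 : nat, s.2) (t.1 : nat, t.2)) =
  fdet (fun s t : 'I_N * 'I_d =>
          (s == t)%:R + A (s.1 : nat, s.2) (t.1 : nat, t.2)).
Proof.
move=> A0; elim: m => [|m <-]; first by rewrite addn0.
rewrite addnS -(fdet_reindex _ (add_site_bij _)) fdet_upper.
  rewrite -[RHS]mulr1; congr (_ * _).
    apply: eq_fdet => -[x i] [y j].
    rewrite (inj_eq (bij_inj (add_site_bij _))) /=.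
    have bumpE (z : 'I_(N + m)) : bump (N + m) z = z by exact: (lift_max z).
    by rewrite !bumpE.
  rewrite -[RHS](fdet1 K 'I_d); apply: eq_fdet => i j.
  rewrite (inj_eq (bij_inj (add_site_bij _))) A0 /= ?leq_addr //.
  by rewrite addr0.
move=> i j.
rewrite (inj_eq (bij_inj (add_site_bij _))) A0 /= ?leq_addr //.
by rewrite addr0.
Qed.

Lemma sum_delta n (V : lmodType K) (F : nat -> V) z :
  \sum_(y < n) (y == z :> nat)%:R *: F y = if (z < n)%N then F z else 0.
Proof.
case: ltnP => zn.
  rewrite (bigD1 (Ordinal zn)) //= eqxx scale1r big1 ?addr0 // => y yz.
  by rewrite -val_eqE /= in yz; rewrite (negbTE yz) scale0r.
rewrite big1 // => y _; case: eqP => [yz|]; last by rewrite scale0r.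
by have := ltn_ord y; rewrite yz ltnNge zn.
Qed.

End BlockDet.

(** * Truncated Jacobi operators with a boundary condition *)

Section TruncatedJacobi.
Variables (K : fieldType) (d p : nat).
Implicit Types (a s b : nat -> 'M[K]_d) (k : K).

(* Block (x+1, y+1) of H_c - (k + 1/k) on the sites 1, ..., p+1; the k added at
   the last diagonal block encodes the boundary condition w_{p+2} = k w_{p+1}. *)
Definition jacobi_block a s b k (x y : nat) : 'M[K]_d :=
  (y.+1 == x)%:R *: a x +
  (y == x)%:R *: (b x.+1 - (k + k^-1)%:M + ((x == p)%:R * k)%:M) +
  (y == x.+1)%:R *: s x.+1.

Definition jacobi_det a s b k : K := block_det (fun x y : 'I_p.+1 => jacobi_block a s b k x y).

(** Row [x = p] has no column for [w p.+2]; the extra k on the diagonal supplies this term, because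
    [s p.+1 *m w p.+2 = k *: w p.+1]. Row [x = 0] has no column for the left neighbour, hence the
    case distinction. *)
Lemma jacobi_block_act a s b k m (w : nat -> 'M[K]_(d, m)) (x : nat) : (x <= p)%N ->
  s p.+1 = 1%:M -> w p.+2 = k *: w p.+1 ->
  \sum_(y < p.+1) jacobi_block a s b k x y *m w y.+1 =
  (if x == 0%N then 0 else a x *m w x) + s x.+1 *m w x.+2 + b x.+1 *m w x.+1
  - (k + k^-1) *: w x.+1.
Proof.
move=> xp s1 wp.
under eq_bigr => y _ do rewrite /jacobi_block !mulmxDl -!scalemxAl.
rewrite !big_split /=.
rewrite (sum_delta _ (fun y => (b x.+1 - (k + k^-1)%:M + ((x == p)%:R * k)%:M) *m w y.+1)).
rewrite (sum_delta _ (fun y => s x.+1 *m w y.+1)) !ltnS xp.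
have -> : \sum_(y < p.+1) (y.+1 == x)%:R *: (a x *m w y.+1) =
          if x == 0%N then 0 else a x *m w x.
  case: x xp => [|x] xp /=; first by rewrite big1 // => y _; rewrite scale0r.
  under eq_bigr => y _ do rewrite eqSS.
  by rewrite (sum_delta _ (fun y => a x.+1 *m w y.+1)) leqW.
rewrite -!addrA; congr (_ + _).
rewrite !mulmxDl mulNmx !mul_scalar_mx.
case: (ltngtP x p) xp => // [xp _|-> _].
  by rewrite mul0r scale0r addr0 [RHS]addrC.
by rewrite mul1r s1 mul1mx wp addr0 [RHS]addrC addrA.
Qed.

(* Replace the last block column of the identity by f: the product of the
   truncated operator with this matrix has last column (-a_0 f_0, 0, ..., 0), so a
   cyclic shift of its block rows makes it block triangular.  The determinant of
   the shift stays as a factor independent of the coefficients. *)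
Lemma jacobi_det_shift a s b k (f : nat -> 'M[K]_d) : s p.+1 = 1%:M ->
  (forall x, (x <= p)%N ->
     a x *m f x + s x.+1 *m f x.+2 + b x.+1 *m f x.+1 = (k + k^-1) *: f x.+1) ->
  f p.+2 = k *: f p.+1 ->
  block_det (fun x y : 'I_p.+1 => ((y == ordS x)%:R)%:M : 'M[K]_d) *
    (jacobi_det a s b k * \det (f p.+1)) =
  (\prod_(x < p) \det (a x.+1)) * \det (- (a 0%N *m f 0%N)).
Proof.
move=> s1 fE fp.
pose X (x y : 'I_p.+1) : 'M[K]_d := if y == ord_max then f x.+1 else ((x == y)%:R)%:M.
have <- : block_det X = \det (f p.+1).
  rewrite block_det_recr_row; last first.
    by move=> y; rewrite /X eq_sym (negbTE (neq_lift _ _)) raddf0.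
  rewrite /X eqxx -[RHS]mul1r; congr (_ * _).
  rewrite -[RHS](block_det1 K d p); apply: eq_block_det => x y.
  by rewrite eq_sym (negbTE (neq_lift _ _)) (inj_eq lift_inj).
rewrite /jacobi_det -!block_detM.
rewrite (eq_block_det (B := fun x y : 'I_p.+1 =>
  \sum_(z < p.+1) jacobi_block a s b k (ordS x) z *m X z y)).
  (* The cyclic shift puts row x+1 in position x < p and row 0 in the last position. *)
  have lE (x : 'I_p) : ordS (lift ord_max x) = x.+1 :> nat.
    by rewrite /ordS /= (lift_max x : bump p x = x) modn_small // ltnS.
  have mE : ordS (ord_max : 'I_p.+1) = 0%N :> nat by rewrite /= modnn.
  (* [f] solves the full equation, from which only row 0 omits a term, namely [a 0 *m f 0]. *)
  have XE x : (x <= p)%N -> \sum_(z < p.+1) jacobi_block a s b k x z *m X z ord_max =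
      (if x == 0%N then - (a 0%N *m f 0%N) else 0).
    move=> xp; under eq_bigr => z _ do rewrite /X eqxx.
    rewrite jacobi_block_act // -fE //; case: eqP => [->|_]; last by rewrite subrr.
    by rewrite add0r -[a 0%N *m _ + _ + _]addrA opprD addrCA subrr addr0.
  rewrite block_det_recr_col => [|x]; last by rewrite XE lE.
  rewrite XE mE // eqxx; congr (_ * _).
  have XE' x y : (x < p)%N ->
    \sum_(z < p.+1) jacobi_block a s b k x.+1 z *m X z (lift ord_max y) =
      jacobi_block a s b k x.+1 y.
    move=> xp; under eq_bigr => z _.
      rewrite /X eq_sym (negbTE (neq_lift _ _)) mul_mx_scalar.
      rewrite -val_eqE /= (lift_max y : bump p y = y).
      over.
    by rewrite (sum_delta _ (jacobi_block a s b k x.+1)) leqW.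
  (* Row x now begins with the block [a x.+1] in column x, so the matrix is upper triangular. *)
  rewrite block_det_triangular => [|x y yx]; last first.
    rewrite lE XE' // /jacobi_block eqSS (ltn_eqF yx) (ltn_eqF (leqW yx)).
    by rewrite (ltn_eqF (leqW (leqW yx))) !scale0r !addr0.
  apply: eq_bigr => x _; rewrite lE XE' // /jacobi_block eqxx scale1r.
  by rewrite (ltn_eqF (ltnSn x)) (ltn_eqF (leqnSn x.+1)) !scale0r !addr0.
move=> x y.
rewrite (bigD1 (ordS x)) //= eqxx mul1mx [X in _ + X]big1 ?addr0 // => z zx.
by rewrite (negbTE zx) raddf0 mul0mx.
Qed.

(** This is [jacobi_det_shift] for the free solution [k ^+ x]. It serves to eliminate the
    determinant of the cyclic shift without computing its sign. *)
Lemma jacobi_det_free k : k != 0 ->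
  block_det (fun x y : 'I_p.+1 => ((y == ordS x)%:R)%:M : 'M[K]_d) *
    (jacobi_det (fun=> 1%:M) (fun=> 1%:M) (fun=> 0) k * \det ((k ^+ p.+1)%:M : 'M[K]_d)) =
  \det (- 1%:M : 'M[K]_d).
Proof.
move=> k0; rewrite (@jacobi_det_shift _ _ (fun=> 0) _ (fun x => (k ^+ x)%:M)) //.
- by rewrite big1 ?mul1r ?mul1mx ?expr0 // => x _; rewrite det1.
- move=> x _; rewrite !mul1mx mul0mx addr0 scale_scalar_mx -raddfD /=; congr (_%:M).
  by rewrite !exprS; field.
- by rewrite scale_scalar_mx exprS.
Qed.

Lemma jacobi_det_free_neq0 k : k != 0 -> jacobi_det (fun=> 1%:M) (fun=> 1%:M) (fun=> 0) k != 0.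
Proof.
move=> k0; suff : \det (- 1%:M : 'M[K]_d) != 0.
  by rewrite -(jacobi_det_free k0) !mulf_eq0 !negb_or => /and3P[].
by rewrite -scaleN1r detZ det1 mulr1 signr_eq0.
Qed.

(** Comparing [jacobi_det_shift] for [f] with its free instance cancels the shift factor, the
    determinant of [f p.+1] and the sign in [- f 0]. *)
Lemma jacobi_det_jost a s b k (f : nat -> 'M[K]_d) : k != 0 ->
  a 0%N = 1%:M -> s p.+1 = 1%:M ->
  (forall x, (x <= p)%N ->
     a x *m f x + s x.+1 *m f x.+2 + b x.+1 *m f x.+1 = (k + k^-1) *: f x.+1) ->
  f p.+1 = (k ^+ p.+1)%:M -> f p.+2 = (k ^+ p.+2)%:M ->
  jacobi_det a s b k =
  jacobi_det (fun=> 1%:M) (fun=> 1%:M) (fun=> 0) k *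
  (\det (f 0%N) * \prod_(x < p) \det (a x.+1)).
Proof.
move=> k0 a0 s1 fE fp1 fp2.
have fp : f p.+2 = k *: f p.+1 by rewrite fp2 fp1 scale_scalar_mx exprS.
have := jacobi_det_shift s1 fE fp; rewrite fp1 a0 mul1mx -[- f 0%N]mul1mx mulmxN.
rewrite -mulNmx det_mulmx -(jacobi_det_free k0).
have : \det (- 1%:M : 'M[K]_d) != 0 by rewrite -scaleN1r detZ det1 mulr1 signr_eq0.
rewrite -(jacobi_det_free k0) !mulf_eq0 !negb_or => /and3P[Q0 _ e0].
move: Q0 e0; set Q := block_det _; set e := \det (_ ^+ _)%:M => Q0 e0 QM.
apply: (mulIf e0); apply: (mulfI Q0); rewrite QM; ring.
Qed.

End TruncatedJacobi.

(** * The free resolvent on l2 and the decay of its columns *)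

Section FreeResolvent.
Local Open Scope classical_set_scope.
Variables (R : realType) (d : nat).
Local Notation C := R[i].

Lemma normc_ge0 (x : C) : 0 <= normc x.
Proof. by case: x => u v; apply: sqrtr_ge0. Qed.

Lemma normcX (x : C) n : normc (x ^+ n) = normc x ^+ n.
Proof. by elim: n => [|n IHn]; rewrite ?normc1 // !exprS normcM IHn. Qed.

Lemma normc_lt1 (x : C) : (normc x < 1) = (`|x| < 1).
Proof. by rewrite -ltcR. Qed.

(** The bound is normalised so that the tail telescopes: the terms D (1 - q) q^m sum to D (1 - q^m),
    which is at most D. *)
Lemma nneseries_ltoo_geometric (r : nat -> R) n0 D q :
  (forall n, 0 <= r n) -> 0 <= q < 1 -> 0 <= D ->
  (forall m, r (n0 + m)%N <= D * (1 - q) * q ^+ m) ->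
  (\sum_(0 <= x <oo) (r x)%:E < +oo)%E.
Proof.
move=> r0 /andP[q0 q1] D0 rD.
have S m : \sum_(0 <= x < n0 + m) r x <= \sum_(0 <= x < n0) r x + D * (1 - q ^+ m).
  elim: m => [|m IHm]; first by rewrite addn0 expr0 subrr mulr0 addr0.
  rewrite addnS big_nat_recr //=; apply: le_trans (lerD IHm (rD m)) _.
  by rewrite exprS le_eqVlt; apply/orP; left; apply/eqP; ring.
apply: (@le_lt_trans _ _ (\sum_(0 <= x < n0) r x + D)%:E); last exact: ltry.
apply: lime_le; first by apply: is_cvg_nneseries => n _ _; rewrite lee_fin.
apply: nearW => n; rewrite sumEFin lee_fin.
apply: (@le_trans _ _ (\sum_(0 <= x < n0 + n) r x)).
  by rewrite addnC [leRHS](big_cat_nat (n := n)) //= ?leq_addr // lerDl sumr_ge0.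
by apply: le_trans (S n) _; rewrite lerD2l ler_piMr // gerBl exprn_ge0.
Qed.

(** The kernel of (H_o - lambda)^-1 on the half-line. [phi] solves the free recursion with phi_0 = 0
    and phi_1 = 1, and k^x is the decaying solution; they are glued at y, and their Wronskian 1
    fixes the factor -1. *)
Definition green (k : C) (y x : nat) : C :=
  let phi n := (k ^- n - k ^+ n) / (k^-1 - k) in
  if (x <= y)%N then - phi x * k ^+ y else - phi y * k ^+ x.

Lemma greenE (k : C) y x : k != 0 -> k ^+ 2 != 1 -> (0 < y)%N ->
  green k y x + green k y x.+2 - (k + k^-1) * green k y x.+1 = (x.+1 == y)%:R.
Proof.
move=> k0 k1 y0.
have kk : 1 + - k * k != 0 by rewrite mulNr -expr2 subr_eq0 eq_sym.
rewrite /green; case: (ltngtP x.+1 y) => [xy|yx|xy].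
- have xy1 := ltnW xy; rewrite (ltnW xy1) mulr0n.
  have := expf_neq0 x k0; have := expf_neq0 y k0; rewrite !exprS.
  move: (k ^+ x) (k ^+ y) => u v v0 u0; field.
  by rewrite k0 u0 kk.
- rewrite mulr0n.
  have -> : (if (x <= y)%N then - ((k ^- x - k ^+ x) / (k^-1 - k)) * k ^+ y
             else - ((k ^- y - k ^+ y) / (k^-1 - k)) * k ^+ x) =
            - ((k ^- y - k ^+ y) / (k^-1 - k)) * k ^+ x.
    case: leqP => // xy; suff -> : x = y by [].
    by apply/eqP; rewrite eqn_leq xy -ltnS.
  have := expf_neq0 x k0; have := expf_neq0 y k0; rewrite !exprS.
  move: (k ^+ x) (k ^+ y) => u v v0 u0; field.
  by rewrite k0 v0 kk.
- rewrite -xy leqnSn mulr1n.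
  have := expf_neq0 x k0; rewrite !exprS.
  move: (k ^+ x) => u u0; field.
  by rewrite k0 u0 kk.
Qed.

Lemma green_l2 (k : C) y (j : 'I_d) : k != 0 -> normc k < 1 ->
  l2 (fun x => green k y x *: (delta_mx j 0 : 'cV[C]_d)).
Proof.
move=> k0 k1; split.
  by rewrite /green leq0n expr0 invr1 subrr mul0r oppr0 mul0r scale0r.
set f := (X in (X < _)%E).
have -> : f = (\sum_(0 <= x <oo) (normc (green k y x) ^+ 2)%:E)%E.
  rewrite /f; congr (limn _); apply/funext => n; apply: eq_bigr => x _; congr _%:E.
  rewrite (bigD1 j) //= big1 => [|i ij].
    by rewrite addr0 !mxE !eqxx mulr1.
  by rewrite !mxE (negbTE ij) mulr0 -/(normc 0) normc0 expr0n.
pose q := normc k ^+ 2.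
have q1 : 0 <= q < 1.
  by rewrite /q exprn_ge0 ?normc_ge0 //= expr_lt1 // normc_ge0.
pose c := normc (- ((k ^- y - k ^+ y) / (k^-1 - k))) ^+ 2.
have q2 : 0 < 1 - q by case/andP: q1 => _; rewrite subr_gt0.
(* Beyond y the squared modulus of [green] is exactly c q^x; this constant makes the bound equal to
   c q^(y+1+m). *)
apply: (@nneseries_ltoo_geometric _ y.+1 (c * q ^+ y.+1 / (1 - q)) q) => //.
- by move=> n; rewrite exprn_ge0 ?normc_ge0.
- case/andP: q1 => q0 _.
  by rewrite divr_ge0 ?(ltW q2) // mulr_ge0 ?exprn_ge0 // normc_ge0.
- move=> m; rewrite divfK ?gt_eqF // -mulrA -exprD /green.
  rewrite leqNgt ltnS leq_addr /= normcM exprMn -/c.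
  by rewrite /q normcX -!exprM mulnC.
Qed.

(** [Ro] picks a solution if there is one, and [green] provides one. What follows uses these two
    properties of the chosen solution instead of its formula. *)
Lemma Ro_spec (k : C) y (j : 'I_d) : k != 0 -> normc k < 1 -> (0 < y)%N ->
  let u := Ro (k + k^-1) (ebasis R (y, j)) in
  l2 u /\ (fun x => Ho u x - (k + k^-1) *: u x) = ebasis R (y, j).
Proof.
move=> k0 k1 y0 /=.
pose P := [set u : vseq R d | l2 u /\
  (fun x => Ho u x - (k + k^-1) *: u x) = ebasis R (y, j)].
suff : P (xget (fun=> 0) P) by [].
apply: xgetPex; exists (fun x => green k y x *: (delta_mx j 0 : 'cV[C]_d)).
split; first exact: green_l2.
have k2 : k ^+ 2 != 1.
  apply: contraTneq k1 => k2; rewrite -leNgt.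
  have : normc k ^+ 2 = 1 by rewrite -normcX k2 normc1.
  by move/eqP; rewrite sqrf_eq1 => /orP[/eqP ->//|/eqP kN];
     have := normc_ge0 k; rewrite kN ler0N1.
apply/funext => -[|x]; rewrite /ebasis /=.
  rewrite eq_sym (gtn_eqF y0) /green leq0n expr0 invr1 subrr mul0r oppr0 mul0r.
  by rewrite scale0r scaler0 subrr.
rewrite scalerA -scalerDl -scalerBl greenE //.
by case: eqP; rewrite ?scale1r ?scale0r.
Qed.

Lemma l2_bounded (u : vseq R d) : l2 u -> exists B, forall x j, normc (u x j 0) <= B.
Proof.
case=> _; set f := (X in (X < _)%E) => foo.
have f0 : (0 <= f)%E by apply: nneseries_ge0 => n _ _;
  rewrite lee_fin sumr_ge0 // => j _; rewrite sqr_ge0.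
have ffin : f \is a fin_num by rewrite ge0_fin_numE.
(* For t >= 0, t^2 <= F gives t <= F + 1, which avoids a square root. *)
exists (fine f + 1) => x j.
have : normc (u x j 0) ^+ 2 <= fine f.
  rewrite -lee_fin fineK //.
  apply: le_trans (nneseries_lim_ge x.+1 _); last first.
    by move=> n _ _; rewrite lee_fin sumr_ge0 // => i _; rewrite sqr_ge0.
  rewrite sumEFin lee_fin big_nat_recr //= (bigD1 j) //= addrCA lerDl.
  by rewrite addr_ge0 ?sumr_ge0 // => *; rewrite ?sumr_ge0 // => *; rewrite sqr_ge0.
have := normc_ge0 (u x j 0); nra.
Qed.

(* Beyond the site y, v_x = u_{x+1} - k u_x satisfies v_{x+1} = v_x / k, so a
   bounded u must have v = 0. *)
Lemma Ro_decay (k : C) y (j : 'I_d) x : k != 0 -> normc k < 1 -> (0 < y <= x)%N ->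
  Ro (k + k^-1) (ebasis R (y, j)) x.+1 = k *: Ro (k + k^-1) (ebasis R (y, j)) x.
Proof.
move=> k0 k1 /andP[y0 yx]; have /= := Ro_spec j k0 k1 y0.
set u := Ro _ _ => -[ul2 uE].
pose v n := u (x + n).+1 - k *: u (x + n)%N.
have vS n : v n = k *: v n.+1.
  have := congr1 (@^~ (x + n).+1) uE; rewrite /= /ebasis /= gtn_eqF; last first.
    by rewrite ltnS (leq_trans yx) ?leq_addr.
  move/eqP; rewrite subr_eq0 => /eqP uxn; rewrite /v addnS.
  have -> : u (x + n).+2 = (k + k^-1) *: u (x + n).+1 - u (x + n)%N.
    by rewrite -uxn addrAC subrr add0r.
  rewrite !scalerBr !scalerA mulrDr mulfV // scalerDl scale1r.
  by rewrite addrAC [_ + u _]addrC addrK.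
have vn : forall n, v 0%N = k ^+ n *: v n.
  move: (v) vS => w wS; elim=> [|n IHn]; first by rewrite expr0 scale1r.
  by rewrite IHn wS scalerA -exprSr.
suff : v 0%N = 0 by rewrite /v addn0 => /eqP; rewrite subr_eq0 => /eqP.
have [B uB] := l2_bounded ul2.
apply/matrixP=> i z; rewrite ord1 [RHS]mxE; apply: eq0_normc.
apply/eqP; rewrite eq_le normc_ge0 andbT.
(* Each entry of v_n is at most 2 B in modulus, as |k| < 1; hence each entry of v_0 is at most 2 B
   |k|^n for every n. *)
have kn : (fun n => 2 * B * normc k ^+ n) @ \oo --> 0.
  apply: (@cvg_geometric R (2 * B) (normc k)).
  by rewrite ger0_norm ?normc_ge0.
rewrite -(cvg_lim _ kn) //; apply: limr_ge; first by apply: cvgP kn.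
apply: nearW => n; rewrite (vn n) !mxE normcM normcX mulrC.
rewrite ler_wpM2r ?exprn_ge0 ?normc_ge0 //.
apply: le_trans (le_normcD _ _) _; rewrite normcN normcM.
have := uB (x + n).+1 i; have := uB (x + n)%N i.
have := normc_ge0 (u (x + n)%N i 0); have := normc_ge0 k; nra.
Qed.

End FreeResolvent.

(** * Reduction of the Fredholm determinant to a finite one *)

Section FredholmFinite.
Local Open Scope classical_set_scope.
Variables (R : realType) (d : nat).
Local Notation C := R[i].

(* The sum of the n x n principal minors of A_M is the coefficient of X^n in
   det(1 + X A_M), which does not depend on M >= N. *)
Lemma fredholm_det_finite (A : vseq R d -> vseq R d) N :
  (forall s t, (N < s.1)%N -> entry A s t = 0) ->
  fredholm_det A =
  fdet (fun s t : 'I_N * 'I_d => (s == t)%:R + entry A (site s) (site t)).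
Proof.
move=> A0.
pose g (s t : nat * 'I_d) := entry A (s.1.+1, s.2) (t.1.+1, t.2).
pose P M := fdet (fun s t : 'I_M * 'I_d =>
  (s == t)%:R + 'X * (g (s.1 : nat, s.2) (t.1 : nat, t.2))%:P).
have coefP M n : (P M)`_n = \sum_(S : {set 'I_M * 'I_d} | #|S| == n) minor A S.
  rewrite /P fdet_add1 coef_sum [RHS]big_mkcond; apply: eq_bigr => S _ /=.
  have -> : \matrix_(i < #|S|, j < #|S|) ('X * (g ((enum_val i).1 : nat, (enum_val i).2)
      ((enum_val j).1 : nat, (enum_val j).2))%:P) =
    'X *: map_mx polyC (\matrix_(i < #|S|, j < #|S|)
          entry A (site (enum_val i)) (site (enum_val j))).
    by apply/matrixP=> i j; rewrite !mxE.
  rewrite detZ det_map_mx coefMC coefXn -/(minor A S) eq_sym.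
  by case: eqP => _; rewrite ?mul1r ?mul0r.
have PN M : (N <= M)%N -> P M = P N.
  move=> /subnKC <-.
  pose h (s t : nat * 'I_d) := 'X * (g s t)%:P.
  apply: (fdet_zero_rows (M - N) (A := h)) => s t Ns.
  by rewrite /h /g A0 ?mulr0 ?polyC0 ?mulr0.
have trE n : trace_ext A n = (P N)`_n.
  apply: (@lim_near_cst C^o) => //.
  by exists N => // M /= NM; rewrite -coefP PN.
have -> : fredholm_det A = (P N).[1].
  apply: (@lim_near_cst C^o) => //.
  (* From this index on the partial sums contain all coefficients and equal the value at X = 1. *)
  exists (size (P N)) => // n /= sn.
  rewrite (horner_coef_wide _ sn) /series /= big_mkord.
  by apply: eq_bigr => i _; rewrite expr1n mulr1 trE.
rewrite -/(horner_eval 1 (P N)) rmorph_fdet; apply: eq_fdet => s t.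
by rewrite rmorphD rmorphM /= rmorph_nat /horner_eval hornerX hornerC mul1r.
Qed.

End FredholmFinite.

(** * The Jost solution as a polynomial in k *)

Lemma map_horner_polyC (K : comNzRingType) (k : K) m n (A : 'M[K]_(m, n)) :
  map_mx (horner_eval k) (map_mx polyC A) = A.
Proof. by apply/matrixP=> i j; rewrite !mxE /horner_eval hornerC. Qed.

(** A nonzero difference of size n would have the n distinct roots 1, ..., n, one more than its
    degree. *)
Lemma poly_eq_off0 (K : numDomainType) (P Q : {poly K}) :
  (forall k, k != 0 -> P.[k] = Q.[k]) -> P = Q.
Proof.
move=> PQ; apply/eqP; rewrite -subr_eq0; apply/negPn/negP => PQ0.
have := @max_poly_roots _ (P - Q) [seq n.+1%:R | n <- iota 0 (size (P - Q))] PQ0.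
rewrite size_map size_iota ltnn => /(_ _ _)/notF; apply.
  by apply/allP => _ /mapP[n _ ->]; rewrite /root hornerD hornerN PQ ?subrr ?pnatr_eq0.
rewrite map_inj_uniq ?iota_uniq // => m n /eqP.
by rewrite eqr_nat eqSS => /eqP.
Qed.

Section Jost.
Local Open Scope classical_set_scope.
Variables (R : realType) (d p : nat) (a s b : nat -> 'M[R[i]]_d).
Local Notation C := R[i].
Hypothesis a0 : a 0%N = 1%:M.
Hypothesis a_unit : forall x, (0 < x)%N -> a x \in unitmx.
Hypothesis free_tail : forall x, (p < x)%N -> [/\ a x = 1%:M, s x = 1%:M & b x = 0].

Let a_unitmx x : a x \in unitmx.
Proof. by case: x => [|x]; [rewrite a0 unitmx1|exact: a_unit]. Qed.

(* [jost_rec n] is k^-x f_x(k) at x = p + 1 - n, as a polynomial in k. *)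
Fixpoint jost_rec n : 'M[{poly C}]_d :=
  if n is m.+1 then
    let u := jost_rec m in
    let v := if m is l.+1 then jost_rec l else 1%:M in
    map_mx polyC (invmx (a (p - m))) *m
      (('X^2 + 1) *: u - 'X *: (map_mx polyC (b (p - m).+1) *m u)
       - 'X^2 *: (map_mx polyC (s (p - m).+1) *m v))
  else 1%:M.

(** Truncated subtraction gives [jost_rec 0] for every x > p, so the free tail is built in. *)
Definition jost_mx k x : 'M[C]_d :=
  k ^+ x *: map_mx (horner_eval k) (jost_rec (p.+1 - x)).

Lemma jost_mx_tail k x : (p < x)%N -> jost_mx k x = (k ^+ x)%:M.
Proof.
move=> px; rewrite /jost_mx (eqP (_ : p.+1 - x == 0)%N) //= map_mx1.
by rewrite scale_scalar_mx mulr1.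
Qed.

Lemma jost_rec_horner k x : (x <= p)%N ->
  map_mx (horner_eval k) (jost_rec (p.+1 - x)) = invmx (a x) *m
    ((k ^+ 2 + 1) *: map_mx (horner_eval k) (jost_rec (p.+1 - x.+1))
     - k *: (b x.+1 *m map_mx (horner_eval k) (jost_rec (p.+1 - x.+1)))
     - k ^+ 2 *: (s x.+1 *m map_mx (horner_eval k) (jost_rec (p.+1 - x.+2)))).
Proof.
move=> xp; rewrite subSn // !subSS subnS /= subKn //.
rewrite !(map_mxM, map_mxD, map_mxN, map_mxZ) /= !map_horner_polyC.
rewrite /horner_eval !hornerE.
(* For [p - x = 0] the truncated subtraction yields [jost_rec 0], which is the default branch of
   [v]. *)
by case: (p - x)%N => [|m].
Qed.

Lemma jost_mxE k x : k != 0 ->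
  a x *m jost_mx k x + s x.+1 *m jost_mx k x.+2 + b x.+1 *m jost_mx k x.+1 =
  (k + k^-1) *: jost_mx k x.+1.
Proof.
move=> k0; case: (leqP x p) => xp.
  rewrite /jost_mx jost_rec_horner // -!scalemxAr mulKVmx //.
  set U := map_mx _ (jost_rec (p.+1 - x.+1)); set V := map_mx _ _.
  rewrite !scalerBr !scalerA !exprS.
  have -> : k ^+ x * (k * (k * k ^+ 0) + 1) = (k + k^-1) * (k * k ^+ x) by rewrite expr0; field.
  rewrite -[k ^+ x * k]mulrC; set W := _ *: U.
  have -> : k ^+ x * (k * (k * k ^+ 0)) = k * (k * k ^+ x) by rewrite expr0; ring.
  by rewrite subrK subrK.
have [-> _ _] := free_tail xp; have [_ -> ->] := free_tail (leqW xp : p < x.+1)%N.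
rewrite !jost_mx_tail ?leqW // !mul1mx mul0mx addr0 scale_scalar_mx -raddfD /=.
by congr (_%:M); rewrite !exprS; field.
Qed.

(** The tail determines the solution: since each [a x] is invertible, the recursion can be solved
    downward from x > p. *)
Lemma jostE k : k != 0 -> jost p a s b k = jost_mx k.
Proof.
move=> k0; have : is_jost p a s b k (jost p a s b k).
  apply: xgetPex; exists (jost_mx k); split; last exact: jost_mx_tail.
  by case=> // x _; exact: jost_mxE.
move: (jost _ _ _ _ _) => f [fE ftail].
suff fx n x : (p < x + n)%N -> f x = jost_mx k x.
  by apply/funext => x; apply: (fx p.+1); exact: leq_addl.
elim: n x => [|n IHn] x; first by rewrite addn0 => px; rewrite ftail ?jost_mx_tail.
rewrite addnS -addSn => px.
have f1 := IHn x.+1 px; have f2 : f x.+2 = jost_mx k x.+2.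
  by apply: IHn; rewrite addSn leqW.
have := fE x.+1 isT; rewrite /= f1 f2 -jost_mxE // => /addIr/addIr.
by move/(congr1 (mulmx (invmx (a x)))); rewrite !mulKmx.
Qed.

(** The determinant of [jost_rec] shows that the required polynomial exists, and its values off 0
    determine it. *)
Lemma jost_detE : jost_det p a s b = \det (jost_rec p.+1).
Proof.
have recE k : k != 0 -> (\det (jost_rec p.+1)).[k] = \det (jost p a s b k 0%N).
  by move=> k0; rewrite jostE // /jost_mx scale1r subn0 det_map_mx.
have : [set P : {poly C} | forall k, k != 0 -> P.[k] = \det (jost p a s b k 0%N)]
  (jost_det p a s b) by apply: xgetPex; exists (\det (jost_rec p.+1)).
move=> jE; apply: poly_eq_off0 => k k0.
by rewrite jE // recE.
Qed.

Lemma jost_det_horner k : k != 0 -> (jost_det p a s b).[k] = \det (jost_mx k 0%N).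
Proof. by move=> k0; rewrite jost_detE /jost_mx scale1r subn0 det_map_mx. Qed.

Lemma det_Tp : \det (Tp p a) * \prod_(x < p) \det (a x.+1) = 1.
Proof.
rewrite /Tp big_add1 /= big_mkord.
rewrite (big_morph (fun A : 'M[C]_d => \det A) (@det_mulmx _ _) (det1 _ _)) -big_split.
by rewrite big1 //= => x _; rewrite -det_mulmx mulVmx ?det1.
Qed.

(** At k = 0 the recursion reduces to multiplication by [invmx (a x)], so the determinant collects
    the inverses of all a_x. This settles the point k = 0, where the truncated operator with its
    k^-1 says nothing. *)
Lemma jost_det_horner0 : (jost_det p a s b).[0] = \det (Tp p a).
Proof.
have rec0 x : (x <= p.+1)%N ->
    \det (map_mx (horner_eval 0) (jost_rec (p.+1 - x))) * \prod_(x <= y < p.+1) \det (a y) = 1.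
  move=> xp; rewrite -(subKn xp); move: (p.+1 - x)%N (leq_subr x p.+1) => n {x xp}.
  elim: n => [|n IHn] np.
    by rewrite subn0 subnn /= map_mx1 det1 big_geq // mulr1.
  have npS : (p.+1 - n.+1).+1 = (p.+1 - n)%N by rewrite subSS subSn.
  rewrite jost_rec_horner; last by rewrite subSS leq_subr.
  rewrite big_ltn; last by rewrite subSS ltnS leq_subr.
  rewrite npS -[RHS](IHn (ltnW np)) expr0n /= add0r !scale0r !subr0 scale1r det_mulmx.
  by rewrite mulrACA -det_mulmx mulVmx // det1 mul1r.
have := rec0 0%N isT; rewrite subn0 det_map_mx -jost_detE /horner_eval.
rewrite big_nat_recl // a0 det1 mul1r big_mkord => P0.
have D0 : \prod_(x < p) \det (a x.+1) != 0.
  by have /eqP := det_Tp; apply: contraTneq => ->; rewrite mulr0 eq_sym oner_eq0.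
by apply: (mulIf D0); rewrite P0 det_Tp.
Qed.

(** Holds outside the unit disc as well, as the conjugation argument requires. *)
Lemma jacobi_detE k : k != 0 ->
  jacobi_det p a s b k = @jacobi_det _ d p (fun=> 1%:M) (fun=> 1%:M) (fun=> 0) k *
    ((jost_det p a s b).[k] * \prod_(x < p) \det (a x.+1)).
Proof.
move=> k0; rewrite jost_det_horner //.
have [_ s1 _] := free_tail (ltnSn p).
apply: jacobi_det_jost => // [x _||]; first exact: jost_mxE.
  by rewrite jost_mx_tail.
by rewrite jost_mx_tail.
Qed.

End Jost.

(** * The Fredholm determinant as a quotient of truncated determinants *)

Section FredholmFormula.
Variables (R : realType) (d p : nat) (a s b : nat -> 'M[R[i]]_d).
Local Notation C := R[i].

(** Block of R_o between sites x and y+1: y counts from 0 as in [jacobi_block], while x is the true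
    site, with x = 0 for the boundary value. *)
Definition resolvent_col (k : C) (y x : nat) : 'M[C]_d :=
  \matrix_(i, j) Ro (k + k^-1) (ebasis R (y.+1, j)) x i 0.

Lemma resolvent_colE (k : C) y x : k != 0 -> normc k < 1 ->
  resolvent_col k y x + resolvent_col k y x.+2
  - (k + k^-1) *: resolvent_col k y x.+1 = (x == y)%:R%:M.
Proof.
move=> k0 k1; apply/matrixP=> i j; rewrite !mxE.
have [_ /(congr1 (fun u : vseq R d => u x.+1 i 0))] := Ro_spec j k0 k1 (ltn0Sn y).
rewrite /ebasis /= !mxE eqSS => ->.
by case: eqP => _; rewrite !mxE ?eqxx ?andbT ?mul0rn.
Qed.

Lemma resolvent_col_act (k : C) y x (A : 'M[C]_d) i j :
  (A *m resolvent_col k y x) i j = (A *m Ro (k + k^-1) (ebasis R (y.+1, j)) x) i 0.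
Proof. by rewrite !mxE; apply: eq_bigr => l _; rewrite mxE. Qed.

Lemma Dc_jacobi_det (k : C) : k != 0 -> normc k < 1 ->
  (forall x, (p < x)%N -> [/\ a x = 1%:M, s x = 1%:M & b x = 0]) ->
  Dc a s b k * @jacobi_det _ d p (fun=> 1%:M) (fun=> 1%:M) (fun=> 0) k = jacobi_det p a s b k.
Proof.
move=> k0 k1 tail; rewrite /Dc (negbTE k0).
have R0 y : resolvent_col k y 0 = 0.
  apply/matrixP=> i j; rewrite !mxE.
  by have [[-> _] _] := Ro_spec j k0 k1 (ltn0Sn y); rewrite mxE.
have Rtail y : (y <= p)%N -> resolvent_col k y p.+2 = k *: resolvent_col k y p.+1.
  by move=> yp; apply/matrixP=> i j; rewrite !mxE Ro_decay ?mxE //= ltnS.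
pose G (x y : 'I_p.+1) := resolvent_col k y x.+1.
have LG : @jacobi_det _ d p (fun=> 1%:M) (fun=> 1%:M) (fun=> 0) k * block_det G = 1.
  rewrite /jacobi_det -block_detM -[RHS](block_det1 C d p.+1); apply: eq_block_det => x y.
  have xp : (x <= p)%N by rewrite -ltnS.
  have yp : (y <= p)%N by rewrite -ltnS.
  rewrite (@jacobi_block_act _ d p _ _ _ _ _ (resolvent_col k y)) //; last exact: Rtail.
  rewrite !mul1mx mul0mx addr0 -val_eqE /= -(resolvent_colE y x k0 k1).
  by case: eqP => [->|//]; rewrite R0.
have [_ s1 _] := tail _ (ltnSn p).
have -> : fredholm_det (Vc a s b \o Ro (k + k^-1)) = jacobi_det p a s b k * block_det G.
  (* Row p+1 may be nonzero through a_p - 1; all coefficients of V_c vanish from row p+2 on. *)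
  rewrite (@fredholm_det_finite _ _ _ p.+1); last first.
    case=> [[|x] i] t //= px; rewrite /entry /=.
    have [-> _ _] := tail x px.
    have [_ -> ->] := tail x.+1 (ltnW px).
    by rewrite !subrr !mul0mx !addr0 mxE.
  rewrite /jacobi_det -block_detM; apply: eq_fdet => -[x i] [y j] /=.
  have xp : (x <= p)%N by rewrite -ltnS.
  have yp : (y <= p)%N by rewrite -ltnS.
  rewrite (@jacobi_block_act _ d p _ _ _ _ _ (resolvent_col k y)) //; last exact: Rtail.
  (* At the first site the left neighbour is the boundary value 0, so the term with a_0 vanishes. *)
  have -> : (if x == 0%N :> nat then 0 else a x *m resolvent_col k y x) =
      a x *m resolvent_col k y x by case: eqP => // ->; rewrite R0 mulmx0.
  have -> : ((x, i) == (y, j))%:R = ((x == y :> nat)%:R%:M : 'M[C]_d) i j.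
    by rewrite xpair_eqE mxE -val_eqE /=; case: eqP => _; case: eqP.
  have -> : entry (Vc a s b \o Ro (k + k^-1)) (x.+1, i) (y.+1, j) =
      ((a x - 1%:M) *m resolvent_col k y x + b x.+1 *m resolvent_col k y x.+1 +
       (s x.+1 - 1%:M) *m resolvent_col k y x.+2) i j.
    rewrite /entry /= [LHS]mxE [X in X + _]mxE -!resolvent_col_act.
    by rewrite [RHS]mxE [X in _ = X + _]mxE.
  (* Writing the identity block as H_o - lambda applied to the column makes the free terms cancel
     against the 1's in V_c, leaving H_c - lambda. *)
  rewrite -(resolvent_colE y x k0 k1) !mulmxBl !mul1mx.
  move: (a x *m _) (s x.+1 *m _) (b x.+1 *m _) => A S B; rewrite !mxE; ring.
move: (block_det G) LG (jacobi_det p a s b k) => g LG M.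
by rewrite -mulrA (mulrC g) LG mulr1.
Qed.

End FredholmFormula.

(** * Conjugation symmetry in the self-adjoint case *)

Section SelfAdjoint.
Local Open Scope sesquilinear_scope.
Variables (R : realType) (d p : nat) (a s b : nat -> 'M[R[i]]_d).
Local Notation C := R[i].

Lemma hermitian_entry (A : 'M[C]_d) i j : A = A ^t* -> Num.conj (A j i) = A i j.
Proof. by move=> AE; rewrite {2}AE !mxE. Qed.

(** Transposition exchanges the subdiagonal blocks a_x with the superdiagonal blocks s_x, which
    agree and are Hermitian; on the diagonal b_x is Hermitian and the scalar terms in k are
    conjugated. *)
Lemma jacobi_det_conj (k : C) :
  (forall x, (0 < x)%N -> [/\ a x = s x, a x = a x ^t* & b x = b x ^t*]) ->
  jacobi_det p a s b (Num.conj k) = Num.conj (jacobi_det p a s b k).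
Proof.
move=> sa; rewrite /jacobi_det /block_det rmorph_fdet -[RHS]fdet_tr.
apply: eq_fdet => -[[x _] i] [[y _] j] /=; rewrite !mxE.
rewrite !(rmorphD, rmorphM, rmorphN, rmorphMn, fmorphV, rmorph1) /=.
have -> : (y.+1 == x)%:R * a x i j = (x == y.+1)%:R * Num.conj (s y.+1 j i).
  rewrite eq_sym; case: eqP => [->|_]; last by rewrite !mul0r.
  by have [<- ax _] := sa y.+1 isT; rewrite hermitian_entry.
have -> : (y == x.+1)%:R * s x.+1 i j = (x.+1 == y)%:R * Num.conj (a y j i).
  rewrite eq_sym; case: eqP => [<-|_]; last by rewrite !mul0r.
  by have [<- ax _] := sa x.+1 isT; rewrite hermitian_entry.
rewrite [RHS]addrC addrA [in RHS]addrAC [x == y]eq_sym [j == i]eq_sym.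
case: (eqVneq y x) => [->|_]; last by rewrite !mul0r.
by have [_ _ bx] := sa x.+1 isT; rewrite -(hermitian_entry i j bx).
Qed.

Lemma det_hermitian (A : 'M[C]_d) : A = A ^t* -> Num.conj (\det A) = \det A.
Proof. by move=> AE; rewrite {2}AE det_map_mx det_tr. Qed.

End SelfAdjoint.

(** * Polynomials as entire functions, and the final assembly *)

Lemma derivable_poly (K : numFieldType) (P : {poly K}) (x : K^o) :
  derivable (fun z : K^o => P.[z] : K^o) x 1.
Proof.
elim/poly_ind: P => [|P r IHP].
  under eq_fun do rewrite horner0.
  exact: derivable_cst.
have -> : (fun z : K^o => (P * 'X + r%:P).[z] : K^o) =
    ((fun z : K^o => P.[z] : K^o) \* id) \+ cst r.
  by apply/funext => z; rewrite /= !hornerE.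
apply: derivableD; last exact: derivable_cst.
apply: derivableM; [exact: IHP|exact: derivable_id].
Qed.

Lemma entire_horner (R : realType) (P : {poly R[i]}) (c : R[i]) :
  entire (fun k => P.[k] * c).
Proof.
move=> k; have -> : (fun k : R[i] => P.[k] * c) = horner (P * c%:P).
  by apply/funext => z; rewrite hornerM hornerC.
exact: (@derivable_poly (R[i] : numFieldType)).
Qed.

Theorem theorem1p2 (R : realType) (d q p : nat) (a s b : nat -> 'M[R[i]]_d) :
  (0 < d)%N -> (0 < q)%N -> (0 < p)%N ->
  q = (2 * p - 1)%N \/ q = (2 * p)%N ->
  Jqc q p a s b ->
  [/\ (forall k : R[i], `|k| < 1 ->
         (jost_det p a s b).[k] = Dc a s b k * \det (Tp p a)),
      (exists D : R[i] -> R[i],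
         [/\ entire D,
             forall k : R[i], `|k| < 1 -> D k = Dc a s b k
           & forall k : R[i], (jost_det p a s b).[k] = D k * \det (Tp p a)])
    & Jq q p a s b ->
        (forall x : R[i], x \is Num.real ->
           (jost_det p a s b).[x] \is Num.real) /\
        (forall k : R[i], is_resonance p a s b k <->
           is_resonance p a s b (Num.conj k))].
Proof.
move=> _ _ _ _ [a0 inv tail _ _].
have aU x : (0 < x)%N -> a x \in unitmx by case/inv.
have TpD := det_Tp p a0 aU.
set D := \prod_(x < p) _ in TpD.
have D0 : D != 0 by have /eqP := TpD; apply: contraTneq => ->; rewrite mulr0 eq_sym oner_eq0.
have T0 : \det (Tp p a) != 0.
  by have /eqP := TpD; apply: contraTneq => ->; rewrite mul0r eq_sym oner_eq0.
have DcE k : `|k| < 1 -> (jost_det p a s b).[k] = Dc a s b k * \det (Tp p a).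
  (* At k = 0 the value 1 of [Dc] is part of its definition; elsewhere the nonzero free determinant
     is cancelled. *)
  move=> k1; have [->|k0] := eqVneq k 0.
    by rewrite jost_det_horner0 // /Dc eqxx mul1r.
  apply: (mulIf D0); rewrite -mulrA TpD mulr1.
  apply: (mulfI (@jacobi_det_free_neq0 _ d p k k0)).
  rewrite -jacobi_detE // mulrC Dc_jacobi_det //.
  by rewrite normc_lt1.
split=> //.
  (* The continuation of D_c is the Jost polynomial divided by det T_p. *)
  exists (fun k => (jost_det p a s b).[k] * (\det (Tp p a))^-1); split.
  - exact: entire_horner.
  - by move=> k /DcE ->; rewrite mulfK.
  - by move=> k; rewrite divfK.
case=> _ sa.
have saH x : (0 < x)%N -> [/\ a x = s x, a x = (a x ^t*)%sesqui & b x = (b x ^t*)%sesqui].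
  by case/sa => ? [? _] ?.
(* The Jost polynomial has real coefficients: off 0 it is the quotient of two truncated
   determinants, each conjugated along with k, and of [D], which is real as a product of
   determinants of Hermitian matrices. *)
have conjP : map_poly Num.conj (jost_det p a s b) = jost_det p a s b.
  apply: poly_eq_off0 => k k0.
  rewrite -[k in LHS]conjCK horner_map.
  have kc0 : Num.conj k != 0 by rewrite fmorph_eq0.
  have DE : Num.conj D = D.
    rewrite rmorph_prod; apply: eq_bigr => x _.
    by apply: det_hermitian; case: (saH x.+1 isT).
  apply: (mulIf D0); apply: (mulfI (@jacobi_det_free_neq0 _ d p k k0)).
  rewrite -jacobi_detE // -[in RHS](conjCK k) jacobi_det_conj //.
  rewrite (jacobi_detE a0 aU tail kc0) -/D.
  rewrite !rmorphM /= DE -jacobi_det_conj ?conjCK //.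
  by move=> x _; rewrite trmx1 map_mx1 trmx0 map_mx0.
have Pconj k : (jost_det p a s b).[Num.conj k] = Num.conj (jost_det p a s b).[k].
  by rewrite -horner_map conjP.
split=> [x /CrealP xr|k]; first by apply/CrealP; rewrite -Pconj xr.
(* Conjugation is an involution, so one implication suffices. *)
have res k' : is_resonance p a s b k' -> is_resonance p a s b (Num.conj k').
  case=> kr k1; split; first by rewrite /root Pconj fmorph_eq0.
  rewrite norm_conjC; case: k1 => [|[->|->]]; first by left.
    by right; left; rewrite rmorph1.
  by right; right; rewrite rmorphN1.
by split=> [/res //|/res]; rewrite conjCK.
Qed.
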